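(* Let $\mathcal{L}$ be a countable many-sorted first-order signature, let $\mathcal{K}_\lambda$ be a nonempty class of $\mathcal{L}$-structures, and let $\mu_{\lambda,c}$ be a (contextual posterior) probability measure on a $\sigma$-algebra on $\mathcal{K}_\lambda$ containing all sentence-definable events, with semantic confidence $s_{\lambda,c}$ and Stone measure $\nu_{\lambda,c}$. For every $\mathcal{L}$-sentence $\varphi$, \[ s_{\lambda,c}(\varphi)=\nu_{\lambda,c}(\widehat{\varphi}). \] Consequently, two such contextual presentations over $\mathcal{L}$ induce the same semantic confidence function on all sentences if and only if they induce the same probability measure on the clopen algebra of $S_{\mathcal{L}}$.
   Context: For an $\mathcal{L}$-sentence $\varphi$, $[\![\varphi]\!]_{\mathcal{K}}:=\{\mathfrak{M}\in\mathcal{K}:\mathfrak{M}\models\varphi\}$ (a sentence-definable event), and $s_{\lambda,c}(\varphi):=\mu_{\lambda,c}([\![\varphi]\!]_{\mathcal{K}_\lambda})$. $S_{\mathcal{L}}$ is the Stone space of complete $\mathcal{L}$-theories, with basic clopen sets $\widehat{\varphi}:=\{p\in S_{\mathcal{L}}:\varphi\in p\}$. The map $\pi_{\mathcal{K}}:\mathcal{K}\to S_{\mathcal{L}}$ is $\pi_{\mathcal{K}}(\mathfrak{M}):=\operatorname{Th}(\mathfrak{M})$, the complete theory of $\mathfrak{M}$, and $\nu_{\lambda,c}:=(\pi_{\mathcal{K}_\lambda})_\ast\mu_{\lambda,c}$ is the pushforward measure. *)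

(* Defs.v *)
From HB Require Import structures.
From mathcomp Require Import all_boot all_order all_algebra.
From mathcomp Require Import all_classical all_reals all_analysis.

Set Implicit Arguments.
Unset Strict Implicit.
Unset Printing Implicit Defensive.

Local Open Scope classical_set_scope.

Record signature := Signature {
  sort : countType;
  fsym : countType;
  rsym : countType;
  fdom : fsym -> seq sort;
  fcod : fsym -> sort;
  rdom : rsym -> seq sort }.

(* Syntax is well-sorted by construction. A context lists the sorts of the free
   variables, and the variables are de Bruijn indices into it. *)
Inductive var (L : signature) : seq (sort L) -> sort L -> Type :=
| VZ s G : var (s :: G) s
| VS s t G : var G s -> var (t :: G) s.

Inductive term (L : signature) (G : seq (sort L)) : sort L -> Type :=
| TVar s : var G s -> term G s
| TApp (f : fsym L) : terms G (fdom f) -> term G (fcod f)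
with terms (L : signature) (G : seq (sort L)) : seq (sort L) -> Type :=
| TNil : terms G [::]
| TCons s w : term G s -> terms G w -> terms G (s :: w).

Arguments TNil {L G}.

Inductive formula (L : signature) (G : seq (sort L)) : Type :=
| FBot
| FEq (s : sort L) (t u : term G s)
| FRel (r : rsym L) (a : terms G (rdom r))
| FNot (phi : formula G)
| FAnd (phi psi : formula G)
| FOr (phi psi : formula G)
| FImp (phi psi : formula G)
| FAll (s : sort L) (phi : formula (s :: G))
| FEx (s : sort L) (phi : formula (s :: G)).

Arguments FBot {L G}.

Definition sentence (L : signature) := @formula L [::].

(* [sprod M [:: s1; ...; sn]] is M s1 * ... * M sn. *)
Fixpoint sprod (S : Type) (M : S -> Type) (w : seq S) : Type :=
  if w is s :: w' then (M s * sprod M w')%type else unit.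

Record structure (L : signature) := Structure {
  carrier :> sort L -> Type;
  carrier_inhabited : forall s, inhabited (carrier s);
  finterp : forall f, sprod carrier (fdom f) -> carrier (fcod f);
  rinterp : forall r, sprod carrier (rdom r) -> Prop }.

Section semantics.
Variables (L : signature) (M : structure L).

Fixpoint eval_var (G : seq (sort L)) (s : sort L) (x : var G s) :
    sprod M G -> M s :=
  match x in var G s return sprod M G -> M s with
  | VZ _ _ => fun e => e.1
  | VS _ _ _ y => fun e => eval_var y e.2
  end.

Fixpoint eval_term (G : seq (sort L)) (e : sprod M G) (s : sort L)
    (t : term G s) : M s :=
  match t in term _ s return M s with
  | TVar _ x => eval_var x e
  | TApp f a => finterp (eval_terms e a)
  end
with eval_terms (G : seq (sort L)) (e : sprod M G) (w : seq (sort L))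
    (a : terms G w) : sprod M w :=
  match a in terms _ w return sprod M w with
  | TNil => tt
  | TCons _ _ t b => (eval_term e t, eval_terms e b)
  end.

Fixpoint sat (G : seq (sort L)) (phi : formula G) (e : sprod M G) : Prop :=
  match phi with
  | FBot => False
  | FEq _ t u => eval_term e t = eval_term e u
  | FRel _ a => rinterp (eval_terms e a)
  | FNot p => ~ sat p e
  | FAnd p q => sat p e /\ sat q e
  | FOr p q => sat p e \/ sat q e
  | FImp p q => sat p e -> sat q e
  | FAll s p => forall x : M s, @sat (s :: G) p (x, e)
  | FEx s p => exists x : M s, @sat (s :: G) p (x, e)
  end.

Definition models (phi : sentence L) : Prop := @sat [::] phi tt.

Definition theory_of : set (sentence L) := [set phi | models phi].

End semantics.

(* By the completeness theorem this is consistency. *)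
Definition satisfiable (L : signature) (T : set (sentence L)) : Prop :=
  exists M : structure L, forall phi, T phi -> models M phi.

Definition complete_theory (L : signature) (T : set (sentence L)) : Prop :=
  satisfiable T /\ forall phi, T phi \/ T (FNot phi).

Lemma complete_theory_of (L : signature) (M : structure L) :
  complete_theory (theory_of M).
Proof. by split=> [|phi]; [exists M | exact: EM]. Qed.

Lemma complete_theory_eq (L : signature) (T : set (sentence L)) :
  complete_theory T -> exists M : structure L, T = theory_of M.
Proof.
move=> [[M MT] Tc]; exists M; apply/seteqP; split=> [phi /MT //|phi Mphi].
by have [//|/MT/= /(_ Mphi)] := Tc phi.
Qed.

Definition unit_structure (L : signature) : structure L :=
  @Structure L (fun=> unit) (fun=> inhabits tt) (fun _ _ => tt)
    (fun _ _ => True).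

Section formula_countable.
Variable L : signature.
Local Notation tree := (GenTree.tree nat).

Fixpoint encode_var (G : seq (sort L)) (s : sort L) (x : var G s) : nat :=
  if x is VS _ _ _ y then (encode_var y).+1 else 0.

Definition castT (F : sort L -> Type) (s t : sort L) (x : F s) : option (F t) :=
  if s =P t is ReflectT e then Some (ecast z (F z) e x) else None.
Arguments castT : clear implicits.

Lemma castTK (F : sort L -> Type) (s : sort L) (x : F s) :
  castT F s s x = Some x.
Proof. by rewrite /castT; case: eqP => // e; rewrite eq_axiomK. Qed.

Fixpoint decode_var (G : seq (sort L)) (s : sort L) (n : nat) :
    option (var G s) :=
  match G return option (var G s) with
  | [::] => None
  | t :: G' => if n is m.+1 then omap (@VS L s t G') (decode_var G' s m)
               else castT (var (t :: G')) t s (VZ t G')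
  end.

Lemma encode_varK (G : seq (sort L)) (s : sort L) (x : var G s) :
  decode_var G s (encode_var x) = Some x.
Proof. by elim: x => [t H|t u H y IH] /=; rewrite ?castTK ?IH. Qed.

Fixpoint encode_term (G : seq (sort L)) (s : sort L) (t : term G s) : tree :=
  match t with
  | TVar _ x => GenTree.Leaf (encode_var x)
  | TApp f a => GenTree.Node (pickle f) [:: encode_terms a]
  end
with encode_terms (G : seq (sort L)) (w : seq (sort L)) (a : terms G w) :
    tree :=
  match a with
  | TNil => GenTree.Node 0 [::]
  | TCons _ _ t b => GenTree.Node 1 [:: encode_term t; encode_terms b]
  end.

(* [decode_tm c G] decodes terms of a given sort and argument lists of a given
   word at the same time. *)
Fixpoint decode_tm (G : seq (sort L)) (c : tree) :
    (forall s, option (term G s)) * (forall w, option (terms G w)) :=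
  (fun s => match c with
     | GenTree.Leaf n => omap (@TVar L G s) (decode_var G s n)
     | GenTree.Node k [:: c1] =>
         if unpickle k is Some f then
           obind (fun a => castT (term G) _ s (TApp a))
             ((decode_tm G c1).2 (fdom f))
         else None
     | _ => None
     end,
   fun w => match w return option (terms G w) with
     | [::] => Some TNil
     | s :: w' => match c with
        | GenTree.Node _ [:: c1; c2] =>
            obind (fun t => omap (TCons t) ((decode_tm G c2).2 w'))
              ((decode_tm G c1).1 s)
        | _ => None
        end
     end).

Scheme term_terms_ind := Induction for term Sort Prop
  with terms_term_ind := Induction for terms Sort Prop.
Combined Scheme term_terms_mutind from term_terms_ind, terms_term_ind.

Lemma encode_tmK (G : seq (sort L)) :
  (forall s (t : term G s), (decode_tm G (encode_term t)).1 s = Some t) /\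
  (forall w (a : terms G w), (decode_tm G (encode_terms a)).2 w = Some a).
Proof.
apply: (@term_terms_mutind L G
  (fun s t => (decode_tm G (encode_term t)).1 s = Some t)
  (fun w a => (decode_tm G (encode_terms a)).2 w = Some a)) => //=.
- by move=> s x; rewrite encode_varK.
- by move=> f a IH; rewrite pickleK IH /= castTK.
- by move=> s w t IHt a IHa; rewrite IHt /= IHa.
Qed.

Fixpoint encode_formula (G : seq (sort L)) (phi : formula G) : tree :=
  match phi with
  | FBot => GenTree.Node 0 [::]
  | FEq s t u =>
      GenTree.Node 1 [:: GenTree.Leaf (pickle s); encode_term t; encode_term u]
  | FRel r a => GenTree.Node 2 [:: GenTree.Leaf (pickle r); encode_terms a]
  | FNot p => GenTree.Node 3 [:: encode_formula p]
  | FAnd p q => GenTree.Node 4 [:: encode_formula p; encode_formula q]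
  | FOr p q => GenTree.Node 5 [:: encode_formula p; encode_formula q]
  | FImp p q => GenTree.Node 6 [:: encode_formula p; encode_formula q]
  | FAll s p => GenTree.Node 7 [:: GenTree.Leaf (pickle s); encode_formula p]
  | FEx s p => GenTree.Node 8 [:: GenTree.Leaf (pickle s); encode_formula p]
  end.

Fixpoint decode_formula (G : seq (sort L)) (c : tree) : option (formula G) :=
  match c with
  | GenTree.Node 0 [::] => Some FBot
  | GenTree.Node 1 [:: GenTree.Leaf k; c1; c2] =>
      if unpickle k is Some s then
        obind (fun t => omap (FEq t) ((decode_tm G c2).1 s))
          ((decode_tm G c1).1 s)
      else None
  | GenTree.Node 2 [:: GenTree.Leaf k; c1] =>
      if unpickle k is Some r then
        omap (@FRel L G r) ((decode_tm G c1).2 (rdom r))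
      else None
  | GenTree.Node 3 [:: c1] => omap (@FNot L G) (decode_formula G c1)
  | GenTree.Node 4 [:: c1; c2] =>
      obind (fun p => omap (FAnd p) (decode_formula G c2)) (decode_formula G c1)
  | GenTree.Node 5 [:: c1; c2] =>
      obind (fun p => omap (FOr p) (decode_formula G c2)) (decode_formula G c1)
  | GenTree.Node 6 [:: c1; c2] =>
      obind (fun p => omap (FImp p) (decode_formula G c2)) (decode_formula G c1)
  | GenTree.Node 7 [:: GenTree.Leaf k; c1] =>
      if unpickle k is Some s then
        omap (@FAll L G s) (decode_formula (s :: G) c1)
      else None
  | GenTree.Node 8 [:: GenTree.Leaf k; c1] =>
      if unpickle k is Some s then
        omap (@FEx L G s) (decode_formula (s :: G) c1)
      else None
  | _ => None
  end.

Lemma encode_formulaK (G : seq (sort L)) :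
  pcancel (@encode_formula G) (decode_formula G).
Proof.
move=> phi; elim: phi => {G} //= G.
- by move=> s t u; rewrite pickleK (encode_tmK G).1 /= (encode_tmK G).1.
- by move=> r a; rewrite pickleK (encode_tmK G).2.
- by move=> p ->.
- by move=> p -> q /= ->.
- by move=> p -> q /= ->.
- by move=> p -> q /= ->.
- by move=> s p IH; rewrite pickleK IH.
- by move=> s p IH; rewrite pickleK IH.
Qed.

End formula_countable.

HB.instance Definition _ (L : signature) (G : seq (sort L)) :=
  Countable.copy (formula G) (pcan_type (@encode_formulaK L G)).
HB.instance Definition _ (L : signature) (G : seq (sort L)) :=
  isPointed.Build (formula G) FBot.
HB.instance Definition _ (L : signature) := Countable.on (sentence L).
HB.instance Definition _ (L : signature) := Pointed.on (sentence L).

Definition stone (L : signature) : Type :=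
  {p : set (sentence L) | complete_theory p}.

HB.instance Definition _ (L : signature) := gen_eqMixin (stone L).
HB.instance Definition _ (L : signature) := gen_choiceMixin (stone L).
HB.instance Definition _ (L : signature) :=
  isPointed.Build (stone L) (exist _ _ (complete_theory_of (unit_structure L))).

Definition basic_clopen (L : signature) (phi : sentence L) : set (stone L) :=
  [set p | sval p phi].

Lemma basic_clopen_cover (L : signature) :
  \bigcup_(phi in [set: sentence L]) basic_clopen phi = [set: stone L].
Proof.
apply/seteqP; split=> // p _.
by have [Tp|Tp] := (svalP p).2 FBot; [exists FBot | exists (FNot FBot)].
Qed.

Lemma basic_clopenI (L : signature) (phi psi : sentence L) :
  basic_clopen (FAnd phi psi) = basic_clopen phi `&` basic_clopen psi.
Proof.
by apply/seteqP; split=> -[p /= cp]; rewrite /basic_clopen /=;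
  have [M ->] := complete_theory_eq cp.
Qed.

Lemma basic_clopen_join (L : signature) (phi psi : sentence L) (p : stone L) :
  setT phi -> setT psi -> basic_clopen phi p -> basic_clopen psi p ->
  exists chi, [/\ setT chi, basic_clopen chi p &
    basic_clopen chi `<=` basic_clopen phi `&` basic_clopen psi].
Proof. by move=> _ _ pp pq; exists (FAnd phi psi); rewrite basic_clopenI; split. Qed.

HB.instance Definition _ (L : signature) :=
  @isBaseTopological.Build (stone L) (sentence L) setT (@basic_clopen L)
    (@basic_clopen_cover L) (@basic_clopen_join L).

Lemma basic_clopen_nbhs (L : signature) (p : stone L) (U : set (stone L)) :
  nbhs p U -> exists2 phi, basic_clopen phi p & basic_clopen phi `<=` U.
Proof.
move=> [B [[D _ <-] [phi Dphi pphi] BU]]; exists phi => // q qphi.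
by apply: BU; exists phi.
Qed.

Lemma stone_openE (L : signature) (U : set (stone L)) : open U ->
  U = \bigcup_(phi in [set phi | basic_clopen phi `<=` U]) basic_clopen phi.
Proof.
rewrite openE => oU; apply/seteqP; split=> [p Up|p [phi /= phiU /phiU]] //.
by have [phi pphi phiU] := basic_clopen_nbhs (oU _ Up); exists phi => //.
Qed.

Lemma open_basic_clopen (L : signature) (phi : sentence L) :
  open (basic_clopen phi).
Proof.
rewrite openE => p pphi; exists (basic_clopen phi); split=> //.
by exists [set phi] => //; rewrite bigcup_set1.
Qed.

Lemma basic_clopenC (L : signature) (phi : sentence L) :
  basic_clopen (FNot phi) = ~` basic_clopen phi.
Proof.
by apply/seteqP; split=> -[p /= cp]; rewrite /basic_clopen /=;
  have [M ->] := complete_theory_eq cp.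
Qed.

Lemma clopen_basic_clopen (L : signature) (phi : sentence L) :
  clopen (basic_clopen phi).
Proof.
split; first exact: open_basic_clopen.
by rewrite -openC -basic_clopenC; exact: open_basic_clopen.
Qed.

Definition stone_borel (L : signature) := g_sigma_algebraType (@open (stone L)).

Definition class_space (L : signature) (K : set (structure L))
  (K0 : K !=set0) : Type := {M : structure L | K M}.

Section class_space.
Variables (L : signature) (K : set (structure L)) (K0 : K !=set0).

HB.instance Definition _ := gen_eqMixin (class_space K0).
HB.instance Definition _ := gen_choiceMixin (class_space K0).
HB.instance Definition _ := isPointed.Build (class_space K0)
  (let: exist M KM := cid K0 in exist _ M KM).

Definition sentence_event (phi : sentence L) : set (class_space K0) :=
  [set M | models (sval M) phi].

Definition theory_map (M : class_space K0) : stone L :=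
  exist _ (theory_of (sval M)) (complete_theory_of (sval M)).

End class_space.

Arguments sentence_event {L K} K0 phi.
Arguments theory_map {L K} K0 M.

(* The context (lambda, c) acts only through the class, the sigma-algebra and
   the measure, so it is not a separate field. By [pevents_sigma], the measurable
   sets of [g_sigma_algebraType pevents] are exactly [pevents]. *)
Record presentation (R : realType) (L : signature) := Presentation {
  pclass : set (structure L);
  pclass_neq0 : pclass !=set0;
  pevents : set (set (class_space pclass_neq0));
  pevents_sigma : sigma_algebra setT pevents;
  pevents_sentence : forall phi, pevents (sentence_event pclass_neq0 phi);
  pmeasure : probability (g_sigma_algebraType pevents) R }.

Arguments pevents {R L} p.
Arguments pmeasure {R L} p.

Section presentation.
Variables (R : realType) (L : signature) (P : presentation R L).

Definition confidence (phi : sentence L) : \bar R :=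
  pmeasure P (sentence_event (pclass_neq0 P) phi).

Definition ptheory (M : g_sigma_algebraType (pevents P)) : stone_borel L :=
  theory_map (pclass_neq0 P) M.

Lemma measurable_ptheory : measurable_fun setT ptheory.
Proof.
have mG := @measurability _ _ (g_sigma_algebraType (pevents P)) (stone_borel L)
  setT ptheory (@open (stone L)) erefl.
apply: mG => _ [U oU <-].
rewrite setTI (stone_openE oU) preimage_bigcup bigcup_mkcond.
apply: countable_bigcupT_measurable => [|phi]; first exact: countableP.
case: ifP => // _.
by apply: sub_sigma_algebra; exact: (pevents_sentence P phi).
Qed.

HB.instance Definition _ := isMeasurableFun.Build _ _ _ _ ptheory
  measurable_ptheory.

(* [distribution m f] is the pushforward of m along f, as a probability. *)
Definition stone_measure : probability (stone_borel L) R :=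
  distribution (pmeasure P) ptheory.

End presentation.

(* Main.v *)
(* The preimage of [basic_clopen phi] under M |-> Th(M) is the event defined by
   phi, which gives the first claim. The basic clopen sets form a pi-system and,
   the signature being countable, every open set is a countable union of them.
   They therefore generate the Borel sets, so two Stone measures that agree on
   basic clopen sets agree on all Borel sets. In particular the second claim
   does not need the compactness of the Stone space (that every clopen set is
   basic). *)
Require Import Defs.
From mathcomp Require Import all_boot all_order all_algebra.
From mathcomp Require Import all_classical all_reals all_analysis.

Local Open Scope classical_set_scope.

(** Holds by conversion: [distribution] measures a preimage, which here unfolds to
    [sentence_event]. *)
Lemma confidenceE (R : realType) (L : signature) (P : presentation R L)
    (phi : sentence L) :
  confidence P phi = stone_measure P (basic_clopen phi).
Proof. by []. Qed.

Lemma setI_closed_basic_clopen (L : signature) :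
  setI_closed (range (@basic_clopen L)).
Proof.
by move=> _ _ [phi _ <-] [psi _ <-]; exists (FAnd phi psi);
  rewrite ?basic_clopenI.
Qed.

Lemma stone_borelE (L : signature) :
  @measurable _ (stone_borel L) = <<s range (@basic_clopen L) >>.
Proof.
apply/seteqP; split.
  apply: smallest_sub; first exact: smallest_sigma_algebra.
  (* The union is reindexed by the countable type of all sentences, with empty terms where the basic
     clopen set is not inside [U]. *)
  move=> U /= /stone_openE ->; rewrite bigcup_mkcond.
  apply: (@countable_bigcupT_measurable _
    (g_sigma_algebraType (range (@basic_clopen L)))); first exact: countableP.
  by move=> phi; case: ifP => // _; apply: sub_sigma_algebra; exists phi.
by apply: sub_sigma_algebra2 => _ [phi _ <-]; exact: open_basic_clopen.
Qed.

Lemma stone_probability_unique (R : realType) (L : signature)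
    (m1 m2 : probability (stone_borel L) R) :
  (forall phi, m1 (basic_clopen phi) = m2 (basic_clopen phi)) ->
  forall A : set (stone_borel L), measurable A -> m1 A = m2 A.
Proof.
(* This puts [setT] in the generating family, so that the constant sequence can be the exhaustion in
   [measure_unique]. *)
have clopenT : basic_clopen (FNot FBot) = [set: stone L].
  by rewrite basic_clopenC -setC0; congr (~` _); apply/seteqP;
    split=> // -[p cp]; rewrite /basic_clopen /=;
    have [M ->] := complete_theory_eq cp.
move=> m12; apply: (@measure_unique _ R (stone_borel L)
  (range (@basic_clopen L)) (fun=> setT)).
- exact: stone_borelE.
- exact: setI_closed_basic_clopen.
- by move=> _; exists (FNot FBot).
- exact: bigcup_const.
- by move=> _ [phi _ <-]; exact: m12.
- by move=> _; apply: fin_num_fun_lty; exact: fin_num_measure.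
Qed.

Theorem theorem2p25 (R : realType) (L : signature) :
  (forall (P : presentation R L) (phi : sentence L),
     confidence P phi = stone_measure P (basic_clopen phi)) /\
  (forall P Q : presentation R L,
     (forall phi : sentence L, confidence P phi = confidence Q phi) <->
     (forall U : set (stone L), clopen U ->
        stone_measure P U = stone_measure Q U)).
Proof.
split=> [P phi|P Q]; first exact: confidenceE.
split=> [PQ U [oU _]|PQ phi].
  apply: stone_probability_unique => [phi|]; first by rewrite -!confidenceE.
  (* A clopen set is open, hence a Borel generator. *)
  exact: sub_sigma_algebra.
by rewrite !confidenceE; apply: PQ; exact: clopen_basic_clopen.
Qed.
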